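(* Let $\Theta$ be a variety of algebras and let $H_1, H_2 \in \Theta$. Then $H_1$ and $H_2$ are $LG$-equivalent if and only if they are isotyped.
   Context: Fix a variety $\Theta$ of algebras. Let $X^0$ be an infinite set of variables; $X, Y$ below always denote finite subsets of $X^0$, and $W(X)$ is the free algebra of $\Theta$ over $X$. For $H\in\Theta$, the elements of the set $\mathrm{Hom}(W(X),H)$ of all homomorphisms $W(X)\to H$ are called points. Formulas. The sets $\Upsilon_X$ of formal expressions (for all finite $X\subset X^0$) are defined simultaneously by induction: each equality $w\equiv w'$ with $w,w'\in W(X)$ is in $\Upsilon_X$; if $u,v\in\Upsilon_X$ and $x\in X$, then $u\vee v$, $u\wedge v$, $\neg u$, $\exists x\,u$ are in $\Upsilon_X$; if $s:W(Y)\to W(X)$ is a homomorphism and $u\in\Upsilon_Y$, then $s_*u\in\Upsilon_X$. For $H\in\Theta$ the value $\mathrm{Val}^X_H(u)\subset \mathrm{Hom}(W(X),H)$ of $u\in\Upsilon_X$ is defined by: $\mathrm{Val}^X_H(w\equiv w')=\{\mu : \mu(w)=\mu(w')\}$; $\vee,\wedge,\neg$ are interpreted as union, intersection, complement; $\mu\in \mathrm{Val}^X_H(\exists x\,u)$ iff there is $\nu\in \mathrm{Val}^X_H(u)$ with $\mu(x')=\nu(x')$ for all $x'\in X$, $x'\ne x$; $\mu\in \mathrm{Val}^X_H(s_*u)$ iff $\mu\circ s\in \mathrm{Val}^Y_H(u)$. The algebra of formulas $\Phi(X)$ is the quotient of $\Upsilon_X$ identifying $u$ and $v$ when $\mathrm{Val}^X_H(u)=\mathrm{Val}^X_H(v)$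 for all $H\in\Theta$; it is a Boolean algebra and $\mathrm{Val}^X_H$ is well defined on it. The logical kernel of a point $\mu:W(X)\to H$ is $\mathrm{LKer}(\mu)=\{u\in\Phi(X) : \mu\in \mathrm{Val}^X_H(u)\}$; it is an ultrafilter of $\Phi(X)$. An $X$-type of $H$ is an ultrafilter of $\Phi(X)$ of the form $\mathrm{LKer}(\mu)$ for some point $\mu:W(X)\to H$. Algebras $H_1,H_2\in\Theta$ are isotyped if for every finite $X$ every $X$-type of $H_1$ is an $X$-type of $H_2$ and vice versa. For $T\subset\Phi(X)$ put $T^L_H=\{\mu:W(X)\to H : T\subset \mathrm{LKer}(\mu)\}$, and for $A\subset \mathrm{Hom}(W(X),H)$ put $A^L_H=\bigcap_{\mu\in A}\mathrm{LKer}(\mu)$ (equal to $\Phi(X)$ if $A=\emptyset$); $T^{LL}_H=(T^L_H)^L_H$. Algebras $H_1,H_2\in\Theta$ are $LG$-equivalent if $T^{LL}_{H_1}=T^{LL}_{H_2}$ for every finite $X$ and every $T\subset\Phi(X)$. *)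

(* Defs.v *)
From HB Require Import structures.
From mathcomp Require Import all_boot all_order.
From mathcomp Require Import finmap.
From mathcomp Require Import boolp classical_sets functions cardinality.

Set Implicit Arguments.
Unset Strict Implicit.
Unset Printing Implicit Defensive.

Local Open Scope classical_set_scope.
Local Open Scope quotient_scope.

Record signature := Signature { opsym : Type; arity : opsym -> nat }.

(* The carrier may be empty: W(X) is empty when X is empty and the signature
   has no constant. *)
Record algebra (S : signature) := Algebra {
  carrier :> Type;
  op : forall f : opsym S, ('I_(arity f) -> carrier) -> carrier }.

Record hom (S : signature) (A B : algebra S) := Hom {
  hom_fun :> A -> B;
  hom_op : forall (f : opsym S) (a : 'I_(arity f) -> A),
    hom_fun (op a) = op (fun i => hom_fun (a i)) }.

Lemma hom_ext (S : signature) (A B : algebra S) (f g : hom A B) :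
  (forall x, f x = g x) -> f = g.
Proof.
case: f g => [f fM] [g gM] /= /funext fg; case: _ / fg in gM *.
by rewrite (Prop_irrelevance fM gM).
Qed.

Definition hom_comp (S : signature) (A B C : algebra S)
  (g : hom B C) (f : hom A B) : hom A C.
Proof.
by exists (fun x => g (f x)) => h a; rewrite !hom_op.
Defined.

Inductive term (S : signature) (V : Type) : Type :=
| Var : V -> term S V
| App : forall f : opsym S, ('I_(arity f) -> term S V) -> term S V.
Arguments Var {S V} _.
Arguments App {S V} f _.

HB.instance Definition _ (S : signature) (V : Type) := gen_eqMixin (term S V).
HB.instance Definition _ (S : signature) (V : Type) :=
  gen_choiceMixin (term S V).

Fixpoint eval (S : signature) (V : Type) (A : algebra S) (v : V -> A)
    (t : term S V) : A :=
  match t with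
  | Var x => v x
  | App f a => op (fun i => eval v (a i))
  end.

(* A variety is presented by a set of identities in countably many variables,
   which loses no generality since operations are finitary. *)
Definition variety (S : signature) := term S nat -> term S nat -> Prop.

Definition in_variety (S : signature) (Th : variety S) (A : algebra S) : Prop :=
  forall p q, Th p q -> forall v : nat -> A, eval v p = eval v q.

(* Th-valid equality of terms, so that the quotient is the free algebra of Th
   over V: see free_alg_in_variety and free_alg_universal. *)
Definition term_eqv (S : signature) (Th : variety S) (V : Type)
    (s t : term S V) : bool :=
  `[< forall A : algebra S, in_variety Th A ->
      forall v : V -> A, eval v s = eval v t >].

Lemma term_eqv_refl (S : signature) (Th : variety S) (V : Type) :
  reflexive (@term_eqv S Th V).
Proof. by move=> t; apply/asboolP. Qed.

Lemma term_eqv_sym (S : signature) (Th : variety S) (V : Type) :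
  symmetric (@term_eqv S Th V).
Proof.
by move=> s t; apply/asboolP/asboolP => st A AT v; rewrite (st A AT v).
Qed.

Lemma term_eqv_trans (S : signature) (Th : variety S) (V : Type) :
  transitive (@term_eqv S Th V).
Proof.
move=> t s u /asboolP st /asboolP tu; apply/asboolP => A AT v.
by rewrite (st A AT v) (tu A AT v).
Qed.

Canonical term_equiv (S : signature) (Th : variety S) (V : Type) :=
  EquivRel (@term_eqv S Th V) (@term_eqv_refl S Th V)
    (@term_eqv_sym S Th V) (@term_eqv_trans S Th V).

Definition free_carrier (S : signature) (Th : variety S) (V : Type) :=
  {eq_quot (term_equiv Th V)}.

Definition free_alg (S : signature) (Th : variety S) (V : Type) : algebra S :=
  @Algebra S (free_carrier Th V)
    (fun f a => \pi_(free_carrier Th V) (App f (fun i => repr (a i)))).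

Definition free_gen (S : signature) (Th : variety S) (V : Type) (x : V) :
  free_alg Th V := \pi_(free_carrier Th V) (Var x).

Lemma eval_repr_pi (S : signature) (Th : variety S) (V : Type) (A : algebra S)
    (v : V -> A) (t : term S V) : in_variety Th A ->
  eval v (repr (\pi_(free_carrier Th V) t)) = eval v t.
Proof.
move=> AT; have : repr (\pi_(free_carrier Th V) t) = t
    %[mod free_carrier Th V] by rewrite reprK.
by move/eqmodP => /asboolP /(_ A AT v).
Qed.

Lemma eval_repr_eval (S : signature) (Th : variety S) (V U : Type)
    (A : algebra S) (v : V -> A) (w : U -> free_alg Th V) (t : term S U) :
  in_variety Th A ->
  eval v (repr (eval w t : free_carrier Th V)) =
  eval (fun x => eval v (repr (w x : free_carrier Th V))) t.
Proof.
move=> AT; elim: t => [x|f a IH] //=.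
by rewrite eval_repr_pi //=; congr op; apply/funext => i; apply: IH.
Qed.

Lemma free_alg_in_variety (S : signature) (Th : variety S) (V : Type) :
  in_variety Th (free_alg Th V).
Proof.
move=> p q pq w.
rewrite -[LHS](@reprK _ (free_carrier Th V)).
rewrite -[RHS](@reprK _ (free_carrier Th V)).
apply/eqmodP/asboolP => A AT v.
by rewrite !eval_repr_eval //; apply: AT.
Qed.

Lemma free_alg_universal (S : signature) (Th : variety S) (V : Type)
    (A : algebra S) (v : V -> A) : in_variety Th A ->
  exists! h : hom (free_alg Th V) A, forall x, h (free_gen Th x) = v x.
Proof.
move=> AT.
have hM (f : opsym S) (a : 'I_(arity f) -> free_alg Th V) :
    eval v (repr (op a : free_carrier Th V)) =
    op (fun i => eval v (repr (a i : free_carrier Th V))).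
  by rewrite /= eval_repr_pi.
exists (@Hom S (free_alg Th V) A
  (fun x => eval v (repr (x : free_carrier Th V))) hM).
split=> [x|g gv] /=; first by rewrite eval_repr_pi.
apply: hom_ext => x /=; rewrite -[in RHS](@reprK _ (free_carrier Th V) x).
elim: (repr x) => [y|f a IH] /=; first by rewrite -gv.
have -> : \pi_(free_carrier Th V) (App f a) =
    op (fun i => \pi_(free_carrier Th V) (a i) : free_alg Th V).
  apply/eqmodP/asboolP => B BT w /=; congr op; apply/funext => i.
  by rewrite eval_repr_pi.
by rewrite hom_op; congr op; apply/funext => i; apply: IH.
Qed.

Section Formulas.
Context (X0 : choiceType) (S : signature) (Th : variety S).

Definition W (X : {fset X0}) : algebra S := free_alg Th X.

Definition gen (X : {fset X0}) (x : X) : W X := free_gen Th x.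

Inductive formula (X : {fset X0}) : Type :=
| FEq : W X -> W X -> formula X
| FOr : formula X -> formula X -> formula X
| FAnd : formula X -> formula X -> formula X
| FNot : formula X -> formula X
| FEx : X -> formula X -> formula X
| FSub : forall Y : {fset X0}, hom (W Y) (W X) -> formula Y -> formula X.

HB.instance Definition _ (X : {fset X0}) := gen_eqMixin (formula X).
HB.instance Definition _ (X : {fset X0}) := gen_choiceMixin (formula X).

Fixpoint fval (H : algebra S) (X : {fset X0}) (u : formula X) :
    set (hom (W X) H) :=
  match u with
  | FEq w w' => [set mu | mu w = mu w']
  | FOr u v => fval u `|` fval v
  | FAnd u v => fval u `&` fval v
  | FNot u => ~` fval u
  | FEx x u => [set mu | exists2 nu : hom (W X) H, fval u nu &
                 forall x' : X, x' <> x -> mu (gen x') = nu (gen x')]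
  | FSub Y s u => [set mu | fval u (hom_comp mu s)]
  end.
Arguments fval H {X} u.

Definition formula_eqv (X : {fset X0}) (u v : formula X) : bool :=
  `[< forall H : algebra S, in_variety Th H -> fval H u = fval H v >].

Lemma formula_eqv_refl (X : {fset X0}) : reflexive (@formula_eqv X).
Proof. by move=> u; apply/asboolP. Qed.

Lemma formula_eqv_sym (X : {fset X0}) : symmetric (@formula_eqv X).
Proof. by move=> u v; apply/asboolP/asboolP => uv H HT; rewrite uv. Qed.

Lemma formula_eqv_trans (X : {fset X0}) : transitive (@formula_eqv X).
Proof.
move=> v u w /asboolP uv /asboolP vw; apply/asboolP => H HT.
by rewrite uv // vw.
Qed.

Canonical formula_equiv (X : {fset X0}) :=
  EquivRel (@formula_eqv X) (@formula_eqv_refl X)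
    (@formula_eqv_sym X) (@formula_eqv_trans X).

Definition Phi (X : {fset X0}) := {eq_quot (formula_equiv X)}.

HB.instance Definition _ (X : {fset X0}) := Choice.on (Phi X).

Definition Val (H : algebra S) (X : {fset X0}) (u : Phi X) :
  set (hom (W X) H) := fval H (repr u).

Arguments Val H {X} u.

Lemma Val_pi (H : algebra S) (X : {fset X0}) (u : formula X) :
  in_variety Th H -> Val H (\pi_(Phi X) u) = fval H u.
Proof.
move=> HT; have : repr (\pi_(Phi X) u) = u %[mod Phi X] by rewrite reprK.
by move/eqmodP => /asboolP /(_ H HT).
Qed.

Lemma Phi_ext (X : {fset X0}) (u v : Phi X) :
  (forall H : algebra S, in_variety Th H -> Val H u = Val H v) -> u = v.
Proof.
by move=> uv; rewrite -[u]reprK -[v]reprK; apply/eqmodP/asboolP.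
Qed.

Definition Phi_join (X : {fset X0}) (u v : Phi X) : Phi X :=
  \pi_(Phi X) (FOr (repr u) (repr v)).
Definition Phi_meet (X : {fset X0}) (u v : Phi X) : Phi X :=
  \pi_(Phi X) (FAnd (repr u) (repr v)).
Definition Phi_compl (X : {fset X0}) (u : Phi X) : Phi X :=
  \pi_(Phi X) (FNot (repr u)).

Lemma Val_join (H : algebra S) (X : {fset X0}) (u v : Phi X) :
  in_variety Th H -> Val H (Phi_join u v) = Val H u `|` Val H v.
Proof. by move=> HT; rewrite Val_pi. Qed.
Lemma Val_meet (H : algebra S) (X : {fset X0}) (u v : Phi X) :
  in_variety Th H -> Val H (Phi_meet u v) = Val H u `&` Val H v.
Proof. by move=> HT; rewrite Val_pi. Qed.
Lemma Val_compl (H : algebra S) (X : {fset X0}) (u : Phi X) :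
  in_variety Th H -> Val H (Phi_compl u) = ~` Val H u.
Proof. by move=> HT; rewrite Val_pi. Qed.

Definition Phi_le (X : {fset X0}) : rel (Phi X) :=
  fun u v => Phi_meet u v == u.
Definition Phi_lt (X : {fset X0}) : rel (Phi X) :=
  fun u v => (v != u) && Phi_le u v.

Lemma Phi_meetC (X : {fset X0}) : commutative (@Phi_meet X).
Proof. by move=> u v; apply: Phi_ext => H HT; rewrite !Val_meet // setIC. Qed.
Lemma Phi_joinC (X : {fset X0}) : commutative (@Phi_join X).
Proof. by move=> u v; apply: Phi_ext => H HT; rewrite !Val_join // setUC. Qed.
Lemma Phi_meetA (X : {fset X0}) : associative (@Phi_meet X).
Proof. by move=> u v w; apply: Phi_ext => H HT; rewrite !Val_meet // setIA. Qed.
Lemma Phi_joinA (X : {fset X0}) : associative (@Phi_join X).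
Proof. by move=> u v w; apply: Phi_ext => H HT; rewrite !Val_join // setUA. Qed.
Lemma Phi_joinKI (X : {fset X0}) (v u : Phi X) :
  Phi_meet u (Phi_join u v) = u.
Proof. by apply: Phi_ext => H HT; rewrite Val_meet // Val_join //; apply/setIidPl/subsetUl. Qed.
Lemma Phi_meetKU (X : {fset X0}) (v u : Phi X) :
  Phi_join u (Phi_meet u v) = u.
Proof. by apply: Phi_ext => H HT; rewrite Val_join // Val_meet //; apply/setUidPl; apply: subIsetl. Qed.
Lemma Phi_meetUl (X : {fset X0}) : left_distributive (@Phi_meet X) (@Phi_join X).
Proof.
move=> u v w; apply: Phi_ext => H HT.
by rewrite Val_meet // !Val_join // !Val_meet // setIUl.
Qed.
Lemma Phi_meetxx (X : {fset X0}) : idempotent_op (@Phi_meet X).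
Proof. by move=> u; apply: Phi_ext => H HT; rewrite Val_meet // setIid. Qed.

Fact Phi_display : Order.disp_t. Proof. exact: Order.Disp tt tt. Qed.

(* Only the structure of a distributive lattice is declared canonically, since
   Phi(X) has no bottom and top when W(X) is empty (then Phi(X) is empty).
   As soon as Phi(X) is inhabited, the two lemmas below make it a Boolean
   algebra. *)
HB.instance Definition _ (X : {fset X0}) :=
  Order.isMeetJoinDistrLattice.Build Phi_display (Phi X)
    (fun u v => erefl (Phi_le u v)) (fun u v => erefl (Phi_lt u v))
    (@Phi_meetC X) (@Phi_joinC X) (@Phi_meetA X) (@Phi_joinA X)
    (@Phi_joinKI X) (@Phi_meetKU X) (@Phi_meetUl X) (@Phi_meetxx X).

Lemma Phi_leP (X : {fset X0}) (u v : Phi X) :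
  reflect (forall H : algebra S, in_variety Th H -> Val H u `<=` Val H v)
    (u <= v)%O.
Proof.
apply: (iffP eqP) => [uv H HT|uv].
  by apply/setIidPl; rewrite -Val_meet // uv.
by apply: Phi_ext => H HT; rewrite Val_meet //; apply/setIidPl/uv.
Qed.

Lemma Phi_meet_compl (X : {fset X0}) (u v : Phi X) :
  (Order.meet u (Phi_compl u) <= v)%O.
Proof.
by apply/Phi_leP => H HT; rewrite Val_meet // Val_compl // setICr.
Qed.

Lemma Phi_join_compl (X : {fset X0}) (u v : Phi X) :
  (v <= Order.join u (Phi_compl u))%O.
Proof.
by apply/Phi_leP => H HT; rewrite Val_join // Val_compl // setUCr.
Qed.

End Formulas.

Arguments fval {X0 S Th} H {X} u.
Arguments Val {X0 S Th} H {X} u.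

(* These notions do not mention bottom and top: on a Boolean algebra, a filter
   is proper iff it omits the bottom, and nonempty iff it contains the top. *)
Definition lattice_filter (d : Order.disp_t) (L : latticeType d) (F : set L) :=
  [/\ F !=set0,
      forall u v, F u -> F v -> F (Order.meet u v) &
      forall u v, F u -> (u <= v)%O -> F v].

Definition proper_lattice_filter (d : Order.disp_t) (L : latticeType d)
  (F : set L) := lattice_filter F /\ F <> setT.

Definition lattice_ultrafilter (d : Order.disp_t) (L : latticeType d)
  (F : set L) :=
  proper_lattice_filter F /\
  forall G : set L, proper_lattice_filter G -> F `<=` G -> G = F.

Section Types.
Context (X0 : choiceType) (S : signature) (Th : variety S).

Definition LKer (H : algebra S) (X : {fset X0}) (mu : hom (W Th X) H) :
  set (Phi Th X) := [set u | Val H u mu].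

Definition is_type (H : algebra S) (X : {fset X0}) (T : set (Phi Th X)) :=
  lattice_ultrafilter T /\ exists mu : hom (W Th X) H, T = LKer mu.

Definition isotyped (H1 H2 : algebra S) :=
  forall (X : {fset X0}) (T : set (Phi Th X)),
    is_type H1 T <-> is_type H2 T.

Definition L_points (H : algebra S) (X : {fset X0}) (T : set (Phi Th X)) :
  set (hom (W Th X) H) := [set mu | T `<=` LKer mu].

Arguments L_points H {X} T.

Definition L_formulas (H : algebra S) (X : {fset X0})
  (A : set (hom (W Th X) H)) : set (Phi Th X) := \bigcap_(mu in A) LKer mu.

Definition LL (H : algebra S) (X : {fset X0}) (T : set (Phi Th X)) :
  set (Phi Th X) := L_formulas (L_points H T).

Definition LG_equivalent (H1 H2 : algebra S) :=
  forall (X : {fset X0}) (T : set (Phi Th X)), LL H1 T = LL H2 T.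

End Types.
Arguments isotyped X0 {S} Th H1 H2.
Arguments LG_equivalent X0 {S} Th H1 H2.
Arguments L_points {X0 S Th} H {X} T.

(* Main.v *)
Require Import Defs.
From mathcomp Require Import all_boot all_order.
From mathcomp Require Import finmap.
From mathcomp Require Import boolp classical_sets functions cardinality.

(** A point satisfies exactly one of a formula and its negation, so as soon as
    there is a formula in [X], every logical kernel of an algebra of the variety
    is an ultrafilter ([LKer_ultrafilter]): its types are its logical kernels.

    If the algebras are isotyped, they have the same logical kernels, and the
    closure of [T] depends on these alone: it is the intersection of the logical
    kernels that contain [T] ([LL_sub]).

    Conversely, let [T] be a type of [H1]. As a logical kernel it is its own
    closure in [H1], hence in [H2]. Since [T] is proper, that closure is not an
    intersection of the empty family, so some point of [H2] has a logical kernel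
    containing [T]; by maximality of [T] this kernel is [T] itself ([LG_type]).

    When [W(X)] is empty there may be points but there are no formulas in [X],
    so no logical kernel is an ultrafilter. Both directions survive: the closures
    of [T] are equal, being sets of formulas, and there are no types to
    compare. *)

Set Implicit Arguments.
Unset Strict Implicit.
Unset Printing Implicit Defensive.

Local Open Scope classical_set_scope.

Lemma filter_complement (X0 : choiceType) (S : signature) (Th : variety S)
    (X : {fset X0}) (F : set (Phi Th X)) (u : Phi Th X) :
  lattice_filter F -> F u -> F (Phi_compl u) -> F = setT.
Proof.
move=> [_ FI FS] Fu Fcu; apply/seteqP; split=> // v _.
exact: FS (FI _ _ Fu Fcu) (Phi_meet_compl u v).
Qed.

Lemma LKer_proper_filter (X0 : choiceType) (S : signature) (Th : variety S)
    (H : algebra S) (X : {fset X0}) (mu : hom (W Th X) H) (u0 : Phi Th X) :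
  in_variety Th H -> proper_lattice_filter (LKer mu).
Proof.
move=> HTh; split; first split.
- exists (Phi_join u0 (Phi_compl u0)).
  by rewrite /LKer /= Val_join // Val_compl // setUCr.
- move=> u v uK vK.
  suff : Val H (Phi_meet u v) mu by [].
  by rewrite Val_meet.
- by move=> u v uK /Phi_leP uv; exact: uv uK.
- move=> KT.
  have : LKer mu (Phi_meet u0 (Phi_compl u0)) by rewrite KT.
  by rewrite /LKer /= Val_meet // Val_compl // setICr.
Qed.

(** A filter that properly extends the kernel contains a formula false at [mu]
    and also its negation, which is true at [mu], so it is not proper. The
    formula [u0] only witnesses that there are formulas in [X]: if there are
    none, the kernel is empty and is not a filter. *)
Lemma LKer_ultrafilter (X0 : choiceType) (S : signature) (Th : variety S)
    (H : algebra S) (X : {fset X0}) (mu : hom (W Th X) H) (u0 : Phi Th X) :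
  in_variety Th H -> lattice_ultrafilter (LKer mu).
Proof.
move=> HTh; split; first exact: LKer_proper_filter.
move=> G [Gfilter GT] KG; apply/seteqP; split=> // u Gu.
apply: contrapT => nKu; apply: GT.
apply: (filter_complement Gfilter Gu); apply: KG.
by rewrite /LKer /= Val_compl.
Qed.

(** The point [mu] is itself one of those whose kernels are intersected. *)
Lemma LL_LKer (X0 : choiceType) (S : signature) (Th : variety S)
    (H : algebra S) (X : {fset X0}) (mu : hom (W Th X) H) :
  LL H (LKer mu) = LKer mu.
Proof.
apply/seteqP; split=> [u|u Ku nu]; first by apply.
exact.
Qed.

(** Each kernel intersected in [LL H2 T] is also intersected in [LL H1 T]. A
    formula [u] is at hand when this is proved, so kernels are types here even
    though [X] is arbitrary. *)
Lemma LL_sub (X0 : choiceType) (S : signature) (Th : variety S)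
    (H1 H2 : algebra S) (X : {fset X0}) (T : set (Phi Th X)) :
  in_variety Th H2 ->
  (forall K : set (Phi Th X), is_type H2 K -> is_type H1 K) ->
  LL H1 T `<=` LL H2 T.
Proof.
move=> H2Th types u uLL nu Tnu.
have [] := types (LKer nu).
  by split; [exact: LKer_ultrafilter | exists nu].
move=> _ [mu numu]; rewrite numu; apply: uLL.
by rewrite /L_points /= -numu.
Qed.

(** If no kernel of [H2] contained [T], its closure in [H2] would be the set of
    all formulas; but that closure is [T], which is proper. A kernel of [H2]
    containing [T] equals [T], since [T] is a maximal proper filter. *)
Lemma LG_type (X0 : choiceType) (S : signature) (Th : variety S)
    (H1 H2 : algebra S) (X : {fset X0}) (T : set (Phi Th X)) :
  in_variety Th H2 -> LL H1 T = LL H2 T -> is_type H1 T -> is_type H2 T.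
Proof.
move=> H2Th LLT [Tultra [mu Tmu]]; split=> //.
have [[[[u0 _] _ _] TT] Tmax] := Tultra.
have T_closed : LL H2 T = T by rewrite -LLT Tmu LL_LKer.
have [nu Tnu] : L_points H2 T !=set0.
  apply: contrapT => no_point; apply: TT; rewrite -T_closed.
  apply/seteqP; split=> // u _ nu Tnu.
  by case: no_point; exists nu.
by exists nu; apply/esym/Tmax => //; exact: LKer_proper_filter.
Qed.

Theorem theorem1p10 (X0 : choiceType) (X0_infinite : infinite_set [set: X0]%classic)
    (S : signature) (Th : variety S) (H1 H2 : algebra S)
    (H1_Th : in_variety Th H1) (H2_Th : in_variety Th H2) :
  LG_equivalent X0 Th H1 H2 <-> isotyped X0 Th H1 H2.
Proof.
split=> [LG X T|iso X T].
  by split; apply: LG_type => //; rewrite LG.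
by apply/seteqP; split; apply: LL_sub => // K /iso.
Qed.
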